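(* Let $(X,G,\Phi)$ be a minimal equicontinuous action of a finitely generated group $G$ on a Cantor set $X$, and let $X_0\subset X$ be the set of points with trivial holonomy. Then the set $\{G_x\mid x\in X_0\}$ of stabilizers of points with trivial holonomy is a finite set of conjugate subgroups of $G$ if and only if the action $(X,G,\Phi)$ is locally quasi-analytic.
   Context: An action $(X,G,\Phi)$ is a homomorphism $\Phi:G\to \mathrm{Homeo}(X)$, with $g\cdot x=\Phi(g)(x)$. It is minimal if every orbit is dense. It is equicontinuous if $X$ admits a compatible metric $d$ such that for all $\epsilon>0$ there is $\delta>0$ such that $d(x,y)<\delta$ implies $d(g\cdot x,g\cdot y)<\epsilon$ for all $g\in G$. Stabilizers and holonomy: $G_x=\{g\in G\mid g\cdot x=x\}$ is the stabilizer of $x$, and $[G]_x=\{g\in G_x\mid g|V_g=\mathrm{id}\text{ for some open }V_g\ni x\}$ is the neighborhood stabilizer. A point $x$ has trivial holonomy if $G_x=[G]_x$. Put $X_0=\{x\in X\mid G_x=[G]_x\}$. Locally quasi-analytic (LQA): let $D$ be a metric on $X$ compatible with its topology. The action is LQA if there exists $\epsilon>0$ such that for any open set $U\subset X$ with $\mathrm{diam}(U)<\epsilon$, any non-empty open subset $V\subset U$ and any $g_1,g_2\in G$: if $\Phi(g_1)|V=\Phi(g_2)|V$ then $\Phi(g_1)|U=\Phi(g_2)|U$. *)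

(* Defs.v *)
From HB Require Import structures.
From mathcomp Require Import all_boot all_order all_algebra.
From mathcomp Require Import all_classical all_reals.
From mathcomp Require Import ereal topology cantor.
Set Implicit Arguments.
Unset Strict Implicit.
Unset Printing Implicit Defensive.
Import Order.TTheory GRing.Theory Num.Theory.
Local Open Scope classical_set_scope.
Local Open Scope ring_scope.

Definition homeomorphism (X Y : topologicalType) (f : X -> Y) : Prop :=
  exists g : Y -> X,
    [/\ cancel f g, cancel g f, continuous f & continuous g].

(* The library predicate [cantor_like] is not used here: it does not include
   metrizability, so it does not characterize the Cantor set up to
   homeomorphism. *)
Definition cantor_set (X : topologicalType) : Prop :=
  exists f : X -> cantor_space, homeomorphism f.

Definition finitely_generated (G : groupType) : Prop :=
  exists s : seq G, forall H : {pred G},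
    group_closed H -> {subset s <= H} -> H =i predT.

Definition metric (R : realType) (X : Type) (d : X -> X -> R) : Prop :=
  [/\ forall x y, 0 <= d x y,
      forall x y, d x y = 0 <-> x = y,
      forall x y, d x y = d y x &
      forall x y z, d x z <= d x y + d y z].

Definition compatible_metric (R : realType) (X : topologicalType)
    (d : X -> X -> R) : Prop :=
  metric d /\
  forall x, nbhs x = filter_from [set e : R | 0 < e] (fun e => [set y | d x y < e]).

(* Extended-real valued, so that it is the supremum of the distances also when
   the latter are unbounded; the diameter of the empty set is -oo. *)
Definition diam (R : realType) (X : Type) (d : X -> X -> R) (U : set X) : \bar R :=
  ereal_sup [set (d x y)%:E | x in U & y in U].

Section Actions.
Context (G : groupType) (X : topologicalType) (Phi : G -> X -> X).

(* [Phi] is a group homomorphism from [G] to [Homeo(X)]. *)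
Definition action_by_homeo : Prop :=
  (forall g, homeomorphism (Phi g)) /\
  (forall g h, Phi (g * h)%g = Phi g \o Phi h).

Definition minimal_action : Prop :=
  forall x, dense [set Phi g x | g in [set: G]].

Definition equicontinuous_action (R : realType) : Prop :=
  exists2 d : X -> X -> R, compatible_metric d &
    forall e : R, 0 < e -> exists2 delta : R, 0 < delta &
      forall x y, d x y < delta -> forall g, d (Phi g x) (Phi g y) < e.

Definition stabilizer (x : X) : set G := [set g | Phi g x = x].

Definition nbhs_stabilizer (x : X) : set G :=
  [set g | stabilizer x g /\
           exists2 V : set X, open_nbhs x V & {in V, Phi g =1 id}].

Definition trivial_holonomy : set X :=
  [set x | stabilizer x = nbhs_stabilizer x].

Definition locally_quasi_analytic (R : realType) (D : X -> X -> R) : Prop :=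
  exists2 e : R, 0 < e &
    forall U : set X, open U -> (diam D U < e%:E)%E ->
    forall V : set X, open V -> V !=set0 -> V `<=` U ->
    forall g1 g2 : G,
      {in V, Phi g1 =1 Phi g2} -> {in U, Phi g1 =1 Phi g2}.

End Actions.

Definition conjugate_sets (G : groupType) (H K : set G) : Prop :=
  exists g : G, K = [set conjg h g | h in H].

Definition finite_set_of_conjugates (G : groupType) (S : set (set G)) : Prop :=
  finite_set S /\ forall H K, S H -> S K -> conjugate_sets H K.

(* Main.v *)
(** If the action is LQA, two points with trivial holonomy lying in a common
    small open set have the same stabilizer: an element of one stabilizer is the
    identity near the first point, hence on the whole small set. Compactness then
    gives finiteness, and density of orbits gives conjugacy.

    Conversely, [G] is countable, so by Baire the set [X_0] is dense; if it carries
    finitely many stabilizers, then for one of them, [H], the points with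
    stabilizer [H] are dense in some open set [W]. For a clopen [C] inside [W],
    the relation "[g x] and [g y] are in [C] for the same [g]" is [G]-invariant,
    and by equicontinuity its classes are open. Hence any sufficiently small set
    is moved into [W] by some element of [G], and inside [W] an element which is
    the identity on a non-empty open set lies in [H], so it is the identity on
    [W]. *)
Require Import Defs.
From mathcomp Require Import all_boot all_order all_algebra.
From mathcomp Require Import all_classical all_reals.
From mathcomp Require Import ereal topology cantor.
From mathcomp Require Import lra.
Local Open Scope classical_set_scope.

(** * Cantor sets, Baire category and compatible metrics *)

Section Topology.
Set Implicit Arguments.
Unset Strict Implicit.
Local Open Scope ring_scope.
Import Order.TTheory GRing.Theory Num.Theory.

Lemma homeomorphism_hausdorff (X Y : topologicalType) (f : X -> Y) :
  homeomorphism f -> hausdorff_space Y -> hausdorff_space X.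
Proof.
move=> [g [fK _ cf _]] hY p q pq; apply: (can_inj fK); apply: hY => A B nA nB.
by have [x [Ax Bx]] := pq _ _ (cf p _ nA) (cf q _ nB); exists (f x).
Qed.

Lemma homeomorphism_zero_dimensional (X Y : topologicalType) (f : X -> Y) :
  homeomorphism f -> zero_dimensional Y -> zero_dimensional X.
Proof.
move=> [g [fK _ cf _]] zY x y xy.
have [|U [cU Ux Uy]] := zY (f x) (f y); first by rewrite (can_eq fK).
by exists (f @^-1` U); split=> //; apply: preimage_clopen.
Qed.

Lemma homeomorphism_compact (X Y : topologicalType) (f : X -> Y) :
  homeomorphism f -> compact [set: Y] -> compact [set: X].
Proof.
move=> [g [fK _ _ cg]] cY.
have -> : [set: X] = g @` [set: Y].
  by apply/seteqP; split=> // x _; exists (f x).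
by apply: continuous_compact => //; apply: continuous_subspaceT.
Qed.

Lemma cantor_setP (X : topologicalType) : cantor_set X ->
  [/\ compact [set: X], hausdorff_space X & zero_dimensional X].
Proof.
move=> [f hf]; split.
- exact: homeomorphism_compact hf cantor_space_compact.
- exact: homeomorphism_hausdorff hf cantor_space_hausdorff.
- exact: homeomorphism_zero_dimensional hf cantor_zero_dimensional.
Qed.

Lemma cantor_set_clopen_basis (X : topologicalType) (x : X) (U : set X) :
  cantor_set X -> nbhs x U -> exists2 C : set X, clopen C & C x /\ C `<=` U.
Proof.
move=> /cantor_setP[cX hX zX] /(zero_dimensional_cvg hX zX cX).
by move=> [C [Cx cC] CU]; exists C.
Qed.

(** Regularity yields open sets shrinking from [W], the closure of each next one lying in the
    previous one and in the current [O n]; compactness gives a point common to all closures. *)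
Lemma compact_baire (X : topologicalType) (O : nat -> set X) :
  compact [set: X] -> hausdorff_space X ->
  (forall n, open (O n)) -> (forall n, dense (O n)) -> dense (\bigcap_n O n).
Proof.
move=> cX hX oO dO W W0 oW.
(* The conditions on [p.2] sit inside the existential so that [choice] applies to every pair; [set0]
   is a dummy value when they fail. *)
have step (p : nat * set X) : exists V : set X, p.2 !=set0 -> open p.2 ->
    [/\ V !=set0, open V & closure V `<=` p.2 `&` O p.1].
  case: p => n U /=; have [U0|U0] := pselect (U !=set0); last by exists set0.
  have [oU|oU] := pselect (open U); last by exists set0.
  have [x UOx] := dO n U U0 oU.
  have nx : nbhs x (U `&` O n) by apply: open_nbhs_nbhs; split=> //; apply: openI.
  have [A nA AU] := @compact_regular X x setT hX cX filterT _ nx.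
  exists A° => _ _; split; [by exists x|exact: open_interior|].
  by move=> y /(closureS (@interior_subset _ A)) /AU.
have [s sP] := choice step.
pose V := fix V n := if n is m.+1 then s (m, V m) else W.
have VP n : V n !=set0 /\ open (V n).
  elim: n => [//|n [V0 oV]]; by have [] := sP (n, V n) V0 oV.
have VS n : closure (V n.+1) `<=` V n `&` O n.
  by have [V0 oV] := VP n; have [] := sP (n, V n) V0 oV.
have Vle m n : (m <= n)%N -> V n `<=` V m.
  move=> /subnK <-; elim: (n - m)%N => [//|k IH] x.
  by rewrite addSn => /subset_closure /VS[/IH].
have FF : ProperFilter (filter_from setT V).
  apply: filter_from_proper; last by move=> n _; case: (VP n).
  apply: filter_from_filter; first by exists 0%N.
  move=> m n _ _; exists (maxn m n) => // x Vx.
  by split; apply: Vle Vx; rewrite ?leq_maxl ?leq_maxr.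
have [|p [_ clp]] := cX _ FF; first by exists 0%N.
have pV n : closure (V n) p.
  by move=> B nB; apply: clp => //; exists n.
(* Membership in [closure (V 1)] puts [p] in [V 0], which is [W]; membership in [closure (V n.+1)]
   puts it in [O n]. *)
by exists p; split=> [|n _]; [have [] := VS _ _ (pV 1%N)|have [] := VS _ _ (pV n.+1)].
Qed.

(** Induction on the list of indices: either the first set is dense in [W], or it misses some
    non-empty open [V] inside [W], where the union of the other sets is still dense. *)
Lemma finite_cover_somewhere_dense (X : topologicalType) (T : choiceType)
    (S : set T) (A : T -> set X) (W : set X) : finite_set S ->
  W !=set0 -> open W ->
  (forall V, V `<=` W -> V !=set0 -> open V -> V `&` \bigcup_(i in S) A i !=set0) ->
  exists2 i, S i & exists W', [/\ W' `<=` W, W' !=set0, open W' &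
    forall V, V `<=` W' -> V !=set0 -> open V -> V `&` A i !=set0].
Proof.
move=> /finite_seqP[s ->]; elim: s W => [|i s IH] W W0 oW dW.
  by have [x [_ [j]]] := dW W (fun _ => id) W0 oW; rewrite /= in_nil.
have [dA|/existsNP[V /not_implyP[VW /not_implyP[V0 /not_implyP[oV VA]]]]] :=
    pselect (forall V, V `<=` W -> V !=set0 -> open V -> V `&` A i !=set0).
  by exists i; [rewrite /= mem_head|exists W; split].
have [|j sj [W' [W'V W'0 oW' dW']]] := IH V V0 oV.
  move=> U UV U0 oU; have [x [Ux [j /=]]] := dW U (subset_trans UV VW) U0 oU.
  rewrite in_cons => /orP[/eqP-> Aix|sj Ajx]; last by exists x; split=> //; exists j.
  by case: VA; exists x; split=> //; apply: UV.
exists j; first by rewrite /= in_cons sj orbT.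
by exists W'; split=> //; apply: subset_trans VW.
Qed.

Lemma compact_finite_representatives (X : topologicalType) (E : X -> X -> Prop) :
  compact [set: X] -> (forall x, nbhs x (E x)) ->
  exists2 B : set X, finite_set B & forall x, exists2 b, B b & E b x.
Proof.
move=> /compact_near_coveringP cX nE.
(* Finite sets directed by inclusion: once [B] contains [x], it serves all points of [E x], so
   near-covering compactness produces one [B] for the whole space. *)
pose F := filter_from finite_set (fun A : set X => [set B | finite_set B /\ A `<=` B]).
have FF : ProperFilter F.
  apply: filter_from_proper; last by move=> A fA; exists A; split.
  apply: filter_from_filter; first by exists set0.
  move=> A B fA fB; exists (A `|` B); first by rewrite /= finite_setU; split.
  by move=> C [fC]; rewrite subUset => -[].
have [x _|A fA AP] := cX _ F (fun B x => exists2 b, B b & E b x) _.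
  exists (E x, [set B | finite_set B /\ [set x] `<=` B]) => /=.
    by split=> //; exists [set x] => //; apply: finite_set1.
  by move=> [y B] /= [Exy [_ xB]]; exists x => //; apply: xB.
by exists A => // x; apply: (AP A) => //; split.
Qed.

(** A Lebesgue number for the cover by the classes of [E]. Reflexivity follows from the neighborhood
    condition, so the Euclidean law makes [E] an equivalence relation. *)
Lemma compatible_metric_uniform_classes (R : realType) (X : topologicalType)
    (d : X -> X -> R) (E : X -> X -> Prop) :
  compact [set: X] -> compatible_metric d ->
  (forall x y z, E x y -> E x z -> E y z) -> (forall x, nbhs x (E x)) ->
  exists2 eta : R, 0 < eta & forall x y, d x y < eta -> E x y.
Proof.
move=> /compact_near_coveringP cX [[_ _ _ dtri] dnb] Etr nE.
pose P (t : R) x := forall y, d x y < t -> E x y.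
have [x _|eta /= eta0 etaP] := cX _ (0 : R)^'+ P _.
  have := nE x; rewrite dnb => -[r /= r0 rE].
  exists ([set y | d x y < r / 2], [set t | t < r / 2]) => /=.
    by split; [rewrite dnb; exists (r / 2); rewrite //= divr_gt0|
               apply: nbhs_right_lt; rewrite divr_gt0].
  move=> [y t] /= [xy tr] z yz; apply: (Etr x); apply: rE => /=.
    by rewrite (lt_trans xy)// ltr_pdivrMr// ltr_pMr// ltr1n.
  rewrite (le_lt_trans (dtri x y z))// [r]splitr ltrD//; exact: lt_trans tr.
exists (eta / 2); first by rewrite divr_gt0.
move=> x y xy; apply: (etaP (eta / 2)) => //=; last by rewrite divr_gt0.
rewrite sub0r normrN gtr0_norm ?divr_gt0//.
by rewrite ltr_pdivrMr// ltr_pMr// ltr1n.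
Qed.

Lemma open_moved_points (X : topologicalType) (f : X -> X) :
  hausdorff_space X -> continuous f -> open [set x | f x <> x].
Proof.
rewrite open_hausdorff => hX cf; rewrite openE => x /= /eqP /hX[[A B] /= [fA xB] [oA oB AB]].
rewrite !inE in fA xB.
have nA : nbhs x (f @^-1` A) by exact: cf x _ (open_nbhs_nbhs (conj oA fA)).
have nB := open_nbhs_nbhs (conj oB xB).
apply: (@filterS _ (nbhs x) _ (f @^-1` A `&` B)); last exact: filterI.
move=> y [/= Ay By] fy.
suff : set0 y by [].
by rewrite -(eqP AB); split=> //; rewrite -fy.
Qed.

Lemma compatible_metric_small_open (R : realType) (X : topologicalType)
    (d : X -> X -> R) (r : R) (x : X) : compatible_metric d -> 0 < r ->
  exists U : set X, [/\ open U, U x & (diam d U < r%:E)%E].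
Proof.
move=> [[_ _ dsym dtri] dnb] r0.
have : nbhs x [set y | d x y < r / 3].
  by rewrite dnb; exists (r / 3); rewrite //= divr_gt0.
rewrite nbhsE => -[U [oU Ux] Ur]; exists U; split=> //.
(* Thirds rather than halves: a supremum only preserves the weak inequality, so slack is left below
   [r]. *)
apply: (@le_lt_trans _ _ (r / 3 + r / 3)%:E); last by rewrite lte_fin; lra.
apply: ge_ereal_sup => _ [y Uy [z Uz <-]]; rewrite lee_fin.
by rewrite (le_trans (dtri y x z))// lerD// ltW// ?(dsym y x); apply: Ur.
Qed.

Lemma diam_lt (R : realType) (X : Type) (d : X -> X -> R) (U : set X) (r : R) x y :
  (diam d U < r%:E)%E -> U x -> U y -> d x y < r.
Proof.
move=> Ur Ux Uy; rewrite -lte_fin (le_lt_trans _ Ur)//.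
by apply: ereal_sup_ubound; exists x => //; exists y.
Qed.

End Topology.

(** * Actions by homeomorphisms and trivial holonomy *)

Section Action.
Set Implicit Arguments.
Unset Strict Implicit.
Local Open Scope ring_scope.
Import Order.TTheory GRing.Theory Num.Theory.

(** The words in the generators and their inverses form a subgroup, hence all of [G]. A word is
    coded as a list of indices and signs, and such lists are countable. *)
Lemma finitely_generated_enum (G : groupType) :
  finitely_generated G -> exists e : nat -> G, forall g, exists n, e n = g.
Proof.
move=> [s sG].
pose L := fix L (w : seq (nat * bool)) : G :=
  if w is (i, b) :: w' then
    ((if b then nth 1 s i else (nth 1 s i)^-1) * L w')%g
  else 1%g.
have Lcat u v : L (u ++ v) = (L u * L v)%g.
  by elim: u => [|[i b] u IH] /=; rewrite ?mul1g// IH mulgA.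
have Linv u : exists v, L v = (L u)^-1%g.
  elim: u => [|[i b] u [v IH]]; first by exists [::]; rewrite invg1.
  exists (v ++ [:: (i, ~~ b)]); rewrite Lcat /= mulg1 IH invgM.
  by case: b; rewrite //= invgK.
have LG g : exists w, L w = g.
  apply/asboolP; suff : g \in [pred g | `[< exists w, L w = g >]] by [].
  rewrite (sG [pred g | `[< exists w, L w = g >]])//.
    split=> [|_ _ /asboolP[u <-] /asboolP[v <-]]; first by apply/asboolP; exists [::].
    apply/asboolP; have [v' <-] := Linv v; exists (u ++ v'); exact: Lcat.
  move=> x xs; apply/asboolP; exists [:: (index x s, true)].
  by rewrite /= mulg1 nth_index.
exists (fun n => L (odflt [::] (unpickle n))) => g.
by have [w <-] := LG g; exists (pickle w); rewrite pickleK.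
Qed.

Context (G : groupType) (X : topologicalType) (Phi : G -> X -> X).
Hypothesis Phi_act : action_by_homeo Phi.

Lemma actM g h x : Phi (g * h)%g x = Phi g (Phi h x).
Proof. by case: Phi_act => _ ->. Qed.

Lemma act1 x : Phi 1%g x = x.
Proof.
have [/(_ 1%g)[f [fK _ _ _]] _] := Phi_act.
by apply: (can_inj fK); rewrite -actM mulg1.
Qed.

Lemma actK g x : Phi g^-1%g (Phi g x) = x.
Proof. by rewrite -actM mulVg act1. Qed.

Lemma actKV g x : Phi g (Phi g^-1%g x) = x.
Proof. by rewrite -actM mulgV act1. Qed.

Lemma act_inj g : injective (Phi g).
Proof. exact: can_inj (actK g). Qed.

Lemma act_continuous g : continuous (Phi g).
Proof. by case: Phi_act => /(_ g)[f []]. Qed.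

Lemma minimal_action_meets x (U : set X) :
  minimal_action Phi -> open U -> U !=set0 -> exists g, U (Phi g x).
Proof.
by move=> mx oU U0; have [y [Uy [g _ gxy]]] := mx x U U0 oU; exists g; rewrite gxy.
Qed.

Lemma stabilizer_act g x h :
  stabilizer Phi (Phi g x) h <-> stabilizer Phi x (conjg h g).
Proof.
rewrite /stabilizer /= conjgE !actM; split=> [->|hx]; first exact: actK.
by apply: (@act_inj g^-1%g); rewrite hx actK.
Qed.

Lemma nbhs_stabilizerP x g :
  nbhs_stabilizer Phi x g <-> \forall y \near x, Phi g y = y.
Proof.
split=> [[_ [V oV gV]]|gx].
  by move: (open_nbhs_nbhs oV); apply: filterS => y Vy; exact/gV/mem_set.
split; first exact: nbhs_singleton gx.
have : nbhs x [set y | Phi g y = y] by []; rewrite nbhsE => -[V oV Vg].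
by exists V => // y /set_mem /Vg.
Qed.

Lemma trivial_holonomyP x : trivial_holonomy Phi x <->
  forall g, Phi g x = x -> \forall y \near x, Phi g y = y.
Proof.
split=> [tx g gx|tx].
  by apply/nbhs_stabilizerP; rewrite -tx.
apply/seteqP; split=> g; first by move=> gx; apply/nbhs_stabilizerP/tx.
by case.
Qed.

Lemma trivial_holonomy_act g x :
  trivial_holonomy Phi x -> trivial_holonomy Phi (Phi g x).
Proof.
move=> /trivial_holonomyP tx; apply/trivial_holonomyP => h hgx.
have /tx hx := (stabilizer_act g x h).1 hgx.
have hgx' : nbhs (Phi g x) (Phi g^-1%g @^-1` [set y | Phi (conjg h g) y = y]).
  by apply: act_continuous; rewrite actK.
apply: filterS _ hgx' => y /=.
by rewrite conjgE !actM actKV => /(can_inj (actK _)).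
Qed.

(* The complement of the trivial holonomy set is the union over [g] of the
   boundaries of the fixed-point sets, hence meager. *)
Lemma dense_trivial_holonomy : compact [set: X] -> hausdorff_space X ->
  finitely_generated G -> dense (trivial_holonomy Phi).
Proof.
move=> cX hX /finitely_generated_enum[e eG].
have -> : trivial_holonomy Phi =
    \bigcap_n ([set x | Phi (e n) x <> x] `|` [set x | Phi (e n) x = x]°).
  apply/seteqP; split=> [x /trivial_holonomyP tx n _|x tx].
    by have [/tx|] := pselect (Phi (e n) x = x); [right|left].
  by apply/trivial_holonomyP => g gx; have [n en] := eG g; have [] := tx n I; rewrite en.
apply: compact_baire => // n.
  apply: openU (open_interior _); exact: open_moved_points hX (@act_continuous _).
move=> W [x Wx] oW; apply: contrapT => W0.
have Wfix y : W y -> Phi (e n) y = y.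
  by move=> Wy; apply: contrapT => ny; apply: W0; exists y; split=> //; left.
apply: W0; exists x; split=> //; right.
by apply: filterS Wfix _; apply: open_nbhs_nbhs.
Qed.

(** * Itineraries with respect to a clopen set *)

Definition same_itinerary (C : set X) (x y : X) : Prop :=
  forall g, C (Phi g x) <-> C (Phi g y).

Lemma same_itinerary_act C g x y :
  same_itinerary C x y -> same_itinerary C (Phi g x) (Phi g y).
Proof. by move=> xy h; rewrite -!actM. Qed.

Lemma same_itinerary_euclidean C x y z :
  same_itinerary C x y -> same_itinerary C x z -> same_itinerary C y z.
Proof. by move=> xy xz g; rewrite -(xy g) -(xz g). Qed.

Lemma same_itinerary_sub C x y : C x -> same_itinerary C x y -> C y.
Proof. by move=> Cx /(_ 1%g); rewrite !act1 => -[/(_ Cx)]. Qed.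

(** By compactness, points closer than some [eta] are both in [C] or both outside it; equicontinuity
    keeps the translates of nearby points within [eta] for all [g] at once. *)
Lemma nbhs_same_itinerary (R : realType) C x : compact [set: X] ->
  equicontinuous_action Phi R -> clopen C -> nbhs x (same_itinerary C x).
Proof.
move=> cX [d cd eq] [oC cC].
have [||eta eta0 etaP] :=
    @compatible_metric_uniform_classes R X d (fun x y => C x <-> C y) cX cd.
- by move=> u v w -> ->.
- move=> u; have [Cu|Cu] := pselect (C u).
    by move: (open_nbhs_nbhs (conj oC Cu)); apply: filterS => v.
  by move: (open_nbhs_nbhs (conj (closed_openC cC) Cu)); apply: filterS => v.
have [delta delta0 deltaP] := eq eta eta0.
rewrite cd.2; exists delta => //= y xy g; exact/etaP/deltaP.
Qed.

(** * From local quasi-analyticity to finitely many conjugate stabilizers *)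

Lemma locally_quasi_analytic_finite_conjugates (R : realType) (D : X -> X -> R) :
  compact [set: X] -> compatible_metric D -> minimal_action Phi ->
  locally_quasi_analytic Phi D ->
  finite_set_of_conjugates [set stabilizer Phi x | x in trivial_holonomy Phi].
Proof.
move=> cX cD mPhi [e e0 lqa].
have stab_sub U x y : open U -> (diam D U < e%:E)%E -> U x -> U y ->
    trivial_holonomy Phi x -> stabilizer Phi x `<=` stabilizer Phi y.
  move=> oU Ue Ux Uy /trivial_holonomyP tx g /tx gx.
  have : nbhs x ([set z | Phi g z = z] `&` U).
    by apply: filterI => //; apply: open_nbhs_nbhs.
  rewrite nbhsE => -[V [oV Vx] VU].
  have V0 : V !=set0 by exists x.
  have := @lqa U oU Ue V oV V0 (fun z Vz => (VU z Vz).2) g 1%g.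
  rewrite /stabilizer /= -[RHS]act1; apply; last exact: mem_set.
  by move=> z /set_mem /VU[gz _]; rewrite act1.
have stab_eq U x y : open U -> (diam D U < e%:E)%E -> U x -> U y ->
    trivial_holonomy Phi x -> trivial_holonomy Phi y ->
    stabilizer Phi x = stabilizer Phi y.
  by move=> oU Ue Ux Uy tx ty; apply/seteqP; split; apply: (stab_sub U).
split.
  have [U UP] := choice (fun x => compatible_metric_small_open x cD e0).
  have [|B fB BP] := @compact_finite_representatives X U cX.
    by move=> x; have [oU Ux _] := UP x; apply: open_nbhs_nbhs.
  apply: (@sub_finite_set _ _ (\bigcup_(b in B)
      [set stabilizer Phi x | x in trivial_holonomy Phi `&` U b])).
    by move=> _ [x tx <-]; have [b Bb Ubx] := BP x; exists b => //; exists x.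
  apply: bigcup_finite => // b _.
  have [[x [tx Ux]]|no] := pselect (trivial_holonomy Phi `&` U b !=set0).
    apply: (@sub_finite_set _ _ [set stabilizer Phi x]); last exact: finite_set1.
    move=> _ [y [ty Uy] <-] /=; have [oU _ Ue] := UP b; exact: (stab_eq (U b)).
  apply: (@sub_finite_set _ _ set0); last exact: finite_set0.
  by move=> H [y tUy _]; case: no; exists y.
move=> _ _ [x tx <-] [y ty <-].
have [U [oU Uy Ue]] := compatible_metric_small_open y cD e0.
have [g Ugx] : exists g, U (Phi g x).
  by apply: minimal_action_meets => //; exists y.
(* Since [conjg h g] is $g^{-1}hg$, the stabilizer of [Phi g x] is that of [x] conjugated by
   [g^-1]. *)
exists g^-1%g.
rewrite -(stab_eq U (Phi g x) y)//; last exact: trivial_holonomy_act.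
apply/seteqP; split=> h.
  by move=> /stabilizer_act hx; exists (conjg h g) => //; rewrite conjgK.
move=> [k kx <-]; apply/stabilizer_act; by rewrite conjgKV.
Qed.

(** * From finitely many stabilizers to local quasi-analyticity *)

Lemma finite_stabilizers_locally_quasi_analytic (R : realType) (D : X -> X -> R) :
  cantor_set X -> compatible_metric D -> finitely_generated G ->
  minimal_action Phi -> equicontinuous_action Phi R ->
  finite_set [set stabilizer Phi x | x in trivial_holonomy Phi] ->
  locally_quasi_analytic Phi D.
Proof.
move=> CX cD fgG mPhi eq finS; have [cX hX _] := cantor_setP CX.
have X0 : [set: X] !=set0 by have [f [g _]] := CX; exists (g point).
have dT := dense_trivial_holonomy cX hX fgG.
pose A H := [set x | trivial_holonomy Phi x /\ stabilizer Phi x = H].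
have [||H _ [W [_ [w Ww] oW WA]]] := @finite_cover_somewhere_dense X _ _ A _ finS X0.
- exact: openT.
- move=> V _ V0 oV; have [x [Vx tx]] := dT V V0 oV.
  by exists x; split=> //; exists (stabilizer Phi x) => //; exists x.
have [C cC [Cw CW]] := cantor_set_clopen_basis CX (open_nbhs_nbhs (conj oW Ww)).
have nE x :=
  nbhs_same_itinerary x cX eq cC.
have [e e0 eP] := compatible_metric_uniform_classes cX cD (@same_itinerary_euclidean C) nE.
exists e => // U oU Ue V oV [v Vv] VU g1 g2 g12 y /set_mem Uy.
have [h hv] : exists h, (same_itinerary C w)° (Phi h v).
  apply: minimal_action_meets => //; first exact: open_interior.
  by exists w; apply: nE.
have {}hv : same_itinerary C w (Phi h v) := interior_subset hv.
(* All points of [U] share the itinerary of [v], so by invariance [h] carries [U] into the class of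
   [w], which lies in [C] and hence in [W]. *)
have UW z : U z -> same_itinerary C w (Phi h z).
  move=> Uz k; rewrite (hv k); apply: same_itinerary_act; apply: eP.
  exact: (diam_lt Ue (VU v Vv) Uz).
have pullW z : U (Phi h^-1%g z) -> W z.
  by move=> /UW; rewrite actKV => /(same_itinerary_sub Cw) /CW.
have pull_open O : open O -> open (Phi h^-1%g @^-1` O).
  by move=> oO; apply: open_comp => // z _; exact: act_continuous.
(* The discrepancy between [g1] and [g2], transported by [h] into [W]: [k] is the identity on the
   image of [V], which contains a point with stabilizer [H], so [k] is in [H]. *)
pose k := (h * (g1^-1 * g2) * h^-1)%g.
have kE z : Phi k z = Phi h (Phi g1^-1%g (Phi g2 (Phi h^-1%g z))) by rewrite !actM.
have [|z [Vz [tz zH]]] := WA _ (fun z Vz => pullW z (VU _ Vz)) _ (pull_open V oV).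
  by exists (Phi h v); rewrite /= actK.
have Hk : H k.
  by rewrite -zH /stabilizer /= kE -g12 ?actK ?actKV//; apply: mem_set.
apply: contrapT => g12y.
(* If [g1] and [g2] differ at [y], then [k] moves [Phi h y]. The points of the image of [U] moved by
   [k] thus form a non-empty open subset of [W], which contains a point with stabilizer [H],
   contradicting that [k] is in [H]. *)
have [||//|t [[/= _ kt] [_ tH]]] := WA
    (Phi h^-1%g @^-1` U `&` [set z | Phi k z <> z]).
- by move=> t [Ut _]; apply: pullW.
- exists (Phi h y); split; rewrite /= ?kE ?actK// => /act_inj gy.
  by apply: g12y; rewrite -{1}gy actKV.
- by apply: openI; [exact: pull_open|exact: open_moved_points hX (@act_continuous k)].
by apply: kt; move: Hk; rewrite -tH.
Qed.

End Action.

Theorem theorem1p8 (R : realType) (X : topologicalType) (G : groupType)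
    (Phi : G -> X -> X) (D : X -> X -> R) :
  cantor_set X ->
  compatible_metric D ->
  finitely_generated G ->
  action_by_homeo Phi ->
  minimal_action Phi ->
  equicontinuous_action Phi R ->
  finite_set_of_conjugates [set stabilizer Phi x | x in trivial_holonomy Phi]
  <-> locally_quasi_analytic Phi D.
Proof.
move=> CX cD fgG aPhi mPhi ePhi; split=> [[finS _]|].
  exact: finite_stabilizers_locally_quasi_analytic.
have [cX _ _] := cantor_setP CX.
exact: locally_quasi_analytic_finite_conjugates.
Qed.
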